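(* Let $w$ be a word in the alphabet $\{X,A\}$ beginning with $X$, and suppose $P_w(x^2,y^2)$ has a factor $f\in\mathbb{Z}[x,y]$ such that $f$ is irreducible in $\mathbb{C}[x,y]$. Then $w$ is not universal.
   Context: A group $G$ is uniquely divisible if for every $g\in G$ and each positive integer $m$ there exists a unique $h\in G$ with $h^m=g$. Words are finite words in the alphabet $\{X,A\}$; for elements $g,a$ of a group, $w(g,a)$ denotes the element obtained by substituting $g$ for the letter $X$ and $a$ for the letter $A$. The word $w$ is universal if for every uniquely divisible group $G$ and every two elements $A,B\in G$ the equation $w(X,A)=B$ has a solution $X\in G$. Writing $w=A^{a_0}XA^{a_1}X\cdots A^{a_{n-1}}XA^{a_n}$ with integers $a_i\ge 0$, the word polynomial of $w$ is $P_w(x,y)=\sum_{k=0}^{n-1}x^k y^{a_0+\cdots+a_k}\in\mathbb{Z}[x,y]$. *)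

(* Defs.v *)
From HB Require Import structures.
From mathcomp Require Import all_boot all_order all_algebra.
From mathcomp Require Export polyXY.
From mathcomp Require Export reals complex.

Set Implicit Arguments.
Unset Strict Implicit.
Unset Printing Implicit Defensive.

Import GRing.Theory.

Inductive letter := LX | LA.

Definition word := seq letter.

Definition is_LX (l : letter) : bool := if l is LX then true else false.

Definition word_eval (G : groupType) (g a : G) (w : word) : G :=
  (\prod_(l <- w) (if l is LX then g else a))%g.

Definition uniquely_divisible (G : groupType) : Prop :=
  forall (g : G) (m : nat), 0 < m -> exists! h : G, (h ^+ m = g)%g.

(* [groupType] bundles a [choiceType] structure on the carrier; classically
   every type has one, so [G] ranges over all uniquely divisible groups. *)
Definition universal (w : word) : Prop :=
  forall G : groupType, uniquely_divisible G ->
    forall a b : G, exists x : G, word_eval x a w = b.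

Definition Xcount (w : word) : nat := count is_LX w.

(* The exponents [:: a_0; ...; a_n] in w = A^a_0 X A^a_1 X ... X A^a_n,
   where n = Xcount w; see [word_of_exponentsK]. *)
Fixpoint exponents (w : word) : seq nat :=
  match w with
  | [::] => [:: 0]
  | LX :: v => 0 :: exponents v
  | LA :: v => (head 0 (exponents v)).+1 :: behead (exponents v)
  end.

Fixpoint word_of_exponents (s : seq nat) : word :=
  match s with
  | [::] => [::]
  | [:: a] => nseq a LA
  | a :: s' => nseq a LA ++ LX :: word_of_exponents s'
  end.

Lemma size_exponents (w : word) : size (exponents w) = (Xcount w).+1.
Proof.
elim: w => [|[] w IHw] //=; first by rewrite IHw.
by rewrite size_behead IHw.
Qed.

Lemma word_of_exponentsK (w : word) : word_of_exponents (exponents w) = w.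
Proof.
elim: w => [|[] w IHw] //=; have := size_exponents w.
  by case: (exponents w) IHw => [|a s] //= ->.
by case: (exponents w) IHw => [|a [|b s]] //= <-.
Qed.

Local Open Scope ring_scope.

(* Bivariate polynomials are elements of {poly {poly R}} as in polyXY: the
   outer variable 'X is x and the inner variable 'Y := 'X%:P is y. *)
Definition word_poly (w : word) : {poly {poly int}} :=
  \sum_(k < Xcount w)
    'X ^+ k * 'Y ^+ (\sum_(i < k.+1) nth 0 (exponents w) i)%N.

(* p(x, y) |-> p(x^2, y^2) *)
Definition sqr_vars (p : {poly {poly int}}) : {poly {poly int}} :=
  map_poly (comp_poly 'X^2) p \Po 'X^2.

Lemma sqr_varsE (p : {poly {poly int}}) (x y : int) :
  (sqr_vars p).[x, y] = p.[x ^+ 2, y ^+ 2].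
Proof.
rewrite /sqr_vars horner_comp hornerXn -polyC_exp.
rewrite -[X in (_.[X]).[y]](comp_polyC _ 'X^2) horner_map.
by rewrite horner_comp hornerXn.
Qed.

Definition irreducible_elt (D : idomainType) (p : D) : Prop :=
  [/\ p != 0, p \isn't a GRing.unit &
      forall q r : D, p = q * r ->
        q \is a GRing.unit \/ r \is a GRing.unit].

Definition to_complex (R : realType) (f : {poly {poly int}}) :
    {poly {poly R[i]}} :=
  map_poly (map_poly intr) f.

(* Main.v *)
Require Import Defs.
From HB Require Import structures.
From mathcomp Require Import all_boot all_order all_algebra.
From mathcomp Require Import boolp classical_sets cardinality ereal.
From mathcomp Require Import measure lebesgue_measure.
From mathcomp Require Import ring.

(** Let C be the complex numbers and S a subgroup of C^* that is torsion-free
and divisible. The group of affine maps z |-> a z + b with slope a in S is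
uniquely divisible: the m-th power of such a map has slope a^m and shift
(1 + a + ... + a^(m-1)) b. Every element of S is a^m for exactly one a in S,
because S is divisible and torsion-free, and the sum is nonzero since it is m
when a = 1 and (a^m - 1) / (a - 1) otherwise ([affine_uniquely_divisible]).

Substitute into w the map z |-> x z + u for X and the homothety z |-> y z
for A: the result has slope x^n y^m, where n and m count the letters X and A,
and shift u P_w(x, y) ([shift_word]). If x and y lie in S and P_w(x, y) = 0,
then a map of slope x^n y^m and shift 1 is not a value of w(-, A), because the
slope of a solution would have to be x itself and the shift would vanish
([not_universal_of_zero]). So w fails to be universal as soon as P_w has a
zero (x, y) with both coordinates in some such S. By Zorn's lemma every
torsion-free subgroup of C^* is contained in such an S
([extend_scalar_group]), and it is enough to find a zero for which x and y
generate a torsion-free group.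

This is where f enters. Since w begins with X, the polynomial P_w is 1 at
x = 0, hence f is a unit there; so f has positive degree in x, and its zeros
satisfy s <> 0. Take a zero (s, t) of f with t real and generic, and put
x = s^2, y = t^2, so that P_w(x, y) = 0. Suppose z = s^m t^n is a root of unity
that is not real. Then m is not 0, since t is real, and m > 0 up to inverting
z. By genericity of t, the irreducible f divides the binomial
x^m y^n - z (cleared of negative exponents); having integer coefficients, it
also divides the complex conjugate of this binomial, hence the difference of
the two, which is a nonzero polynomial in y alone. This contradicts the
positive degree of f in x. Hence z is real, z = 1 or z = -1, and the only root
of unity of the form x^m y^n = z^2 is 1. The squares in P_w(x^2, y^2) are there
to kill this possible sign.

Genericity of t means avoiding the roots of countably many nonzero
polynomials: the resultants with respect to x of f and the binomials, which
are nonzero by Gauss's lemma ([resultant_irreducible_neq0]). Such a t exists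
because countable sets have Lebesgue measure zero ([generic_positive]). *)

Set Implicit Arguments.
Unset Strict Implicit.
Unset Printing Implicit Defensive.

Import Order.TTheory GRing.Theory Num.Theory.
Local Open Scope ring_scope.

(** * The word polynomial and its values *)

Lemma word_poly_nil : word_poly [::] = 0.
Proof. exact: big_ord0. Qed.

Lemma word_poly_X (w : word) : word_poly (LX :: w) = 1 + 'X * word_poly w.
Proof.
rewrite /word_poly /= big_ord_recl /= big_ord1 /= !expr0 mulr1; congr (_ + _).
rewrite big_distrr /=; apply: eq_bigr => k _.
by rewrite [in LHS]big_ord_recl /= add0n exprS mulrA.
Qed.

Lemma word_poly_A (w : word) : word_poly (LA :: w) = 'Y * word_poly w.
Proof.
rewrite /word_poly /= big_distrr /=; apply: eq_bigr => k _.
rewrite [in LHS]big_ord_recl [in RHS]big_ord_recl /= addSn exprS mulrCA.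
congr (_ * (_ * 'Y ^+ (_ + _)%N)).
by apply: eq_bigr => i _; rewrite nth_behead.
Qed.

Definition value (K : comNzRingType) (p : {poly {poly int}}) (x y : K) : K :=
  (map_poly (map_poly intr) p).[x%:P].[y].

Section Value.
Variable K : comNzRingType.
Implicit Types (p q : {poly {poly int}}) (x y : K).

Lemma valueM p q x y : value (p * q) x y = value p x y * value q x y.
Proof. by rewrite /value rmorphM /= !hornerM. Qed.

Lemma value_word_X (w : word) x y :
  value (word_poly (LX :: w)) x y = 1 + x * value (word_poly w) x y.
Proof.
by rewrite /value word_poly_X rmorphD rmorph1 rmorphM /= map_polyX !hornerE.
Qed.

Lemma value_word_A (w : word) x y :
  value (word_poly (LA :: w)) x y = y * value (word_poly w) x y.
Proof.
by rewrite /value word_poly_A rmorphM /= map_polyC /= map_polyX !hornerE.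
Qed.

Lemma value_sqr_vars p x y : value (sqr_vars p) x y = value p (x ^+ 2) (y ^+ 2).
Proof.
rewrite /value /sqr_vars map_comp_poly map_polyXn horner_comp hornerXn.
rewrite -polyC_exp -!map_poly_comp; move: (x ^+ 2) => x2.
elim/poly_ind: p => [|p c /= IHp]; first by rewrite !rmorph0 !horner0.
rewrite !rmorphD !rmorphM /= !map_polyX !map_polyC.
rewrite !(hornerMXaddC, hornerD, hornerM) /= IHp.
by rewrite !hornerC map_comp_poly map_polyXn horner_comp hornerXn. 
Qed.

End Value.

(** * Affine groups with divisible torsion-free slopes *)

Record divisible_scalars (K : fieldType) := DivisibleScalars {
  scalars :> {pred K};
  scalar_neq0 : 0 \notin scalars;
  scalar1 : 1 \in scalars;
  scalarM : forall g h, g \in scalars -> h \in scalars -> g * h \in scalars;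
  scalarV : forall g, g \in scalars -> g^-1 \in scalars;
  scalar_torsion_free :
    forall g m, g \in scalars -> (0 < m)%N -> g ^+ m = 1 -> g = 1;
  scalar_root :
    forall g m, g \in scalars -> (0 < m)%N ->
      exists2 h, h \in scalars & h ^+ m = g }.

(** The pair (a, b) stands for the affine map z |-> a z + b. *)
Definition affine (K : fieldType) (S : divisible_scalars K) :=
  {z : K * K | z.1 \in scalars S}.

Section Affine.
Variables (K : fieldType) (S : divisible_scalars K).
Local Notation aff := (affine S).

HB.instance Definition _ := Choice.copy aff {z : K * K | z.1 \in scalars S}.

Definition Aff (a b : K) (aS : a \in scalars S) : aff := exist _ (a, b) aS.
Definition slope (g : aff) : K := (sval g).1.
Definition shift (g : aff) : K := (sval g).2.

Lemma slopeP (g : aff) : slope g \in scalars S. Proof. exact: (svalP g). Qed.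

Lemma slope_neq0 (g : aff) : slope g != 0.
Proof.
by apply/eqP => g0; have := scalar_neq0 S; rewrite -g0 slopeP.
Qed.

Lemma aff_eq (g h : aff) : slope g = slope h -> shift g = shift h -> g = h.
Proof.
case: g h => [[a b] ga] [[a' b'] hb]; rewrite /slope /shift /= => ea eb.
by apply/val_inj; rewrite /= ea eb.
Qed.

Definition aff_one : aff := Aff 0 (scalar1 S).
Definition aff_mul (g h : aff) : aff :=
  Aff (shift g + slope g * shift h) (scalarM (slopeP g) (slopeP h)).
Definition aff_inv (g : aff) : aff :=
  Aff (- ((slope g)^-1 * shift g)) (scalarV (slopeP g)).

Lemma aff_mulA : associative aff_mul.
Proof.
move=> g h k; apply: aff_eq; rewrite /slope /shift /= ?mulrA //.
by rewrite mulrDr addrA mulrA.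
Qed.
Lemma aff_mul1 : left_id aff_one aff_mul.
Proof. by move=> g; apply: aff_eq; rewrite /slope /shift /= ?add0r mul1r. Qed.
Lemma aff_mulr1 : right_id aff_one aff_mul.
Proof.
by move=> g; apply: aff_eq; rewrite /slope /shift /= ?mulr0 ?addr0 ?mulr1.
Qed.
Lemma aff_mulV : left_inverse aff_one aff_inv aff_mul.
Proof.
move=> g; apply: aff_eq; rewrite /= ?[slope (aff_mul _ _)]mulVf ?slope_neq0 //.
by rewrite /slope /shift /= addNr.
Qed.
Lemma aff_mulrV : right_inverse aff_one aff_inv aff_mul.
Proof.
move=> g; apply: aff_eq; rewrite /= ?[slope (aff_mul _ _)]mulfV ?slope_neq0 //.
by rewrite [LHS]/= /shift /= mulrN mulVKf ?subrr ?slope_neq0.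
Qed.

HB.instance Definition _ :=
  isGroup.Build aff aff_mulA aff_mul1 aff_mulr1 aff_mulV aff_mulrV.

Lemma slopeM (g h : aff) : slope (g * h)%g = slope g * slope h.
Proof. by []. Qed.

Lemma shiftM (g h : aff) : shift (g * h)%g = shift g + slope g * shift h.
Proof. by []. Qed.

Lemma slopeX (g : aff) m : slope (g ^+ m)%g = slope g ^+ m.
Proof. by elim: m => // m IHm; rewrite expgS slopeM IHm exprS. Qed.

Lemma shiftX (g : aff) m :
  shift (g ^+ m)%g = shift g * \sum_(i < m) slope g ^+ i.
Proof.
elim: m => [|m IHm]; first by rewrite big_ord0 mulr0.
rewrite expgS shiftM IHm mulrCA big_ord_recl expr0 mulrDr mulr1.
by rewrite big_distrr; congr (_ + _ * _); apply: eq_bigr => i _; rewrite exprS.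
Qed.

Lemma slope_word (g a : aff) (w : word) :
  slope (word_eval g a w) =
  slope g ^+ Xcount w * slope a ^+ (size w - Xcount w).
Proof.
rewrite /word_eval.
elim: w => [|[] w IHw]; rewrite ?big_nil ?expr0 ?mulr1 // big_cons slopeM IHw.
  by rewrite /= add1n subSS exprS mulrA.
by rewrite /= add0n subSn ?count_size // exprS mulrCA.
Qed.

(** A factor X contributes its shift multiplied by the slope of the prefix
before it, which is x^k y^(a_0 + ... + a_k) for the k-th X; the homothety A
contributes nothing. *)
Lemma shift_word (g a : aff) (w : word) : shift a = 0 ->
  shift (word_eval g a w) = shift g * value (word_poly w) (slope g) (slope a).
Proof.
rewrite /word_eval => a0; elim: w => [|[] w IHw].
- by rewrite big_nil word_poly_nil /value !rmorph0 !horner0 mulr0.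
- by rewrite big_cons shiftM IHw value_word_X mulrDr mulr1 mulrCA.
- by rewrite big_cons shiftM IHw value_word_A a0 add0r mulrCA.
Qed.

End Affine.

(** Characteristic zero is needed for g = 1; otherwise the geometric sum is
(g^m - 1) / (g - 1). *)
Lemma scalar_sum_neq0 (K : numFieldType) (S : divisible_scalars K) g m :
  g \in scalars S -> (0 < m)%N -> \sum_(i < m) g ^+ i != 0.
Proof.
move=> gS m0; have [->|g1] := eqVneq g 1.
  rewrite (eq_bigr (fun=> 1)); last by move=> i _; rewrite expr1n.
  by rewrite sumr_const card_ord pnatr_eq0 -lt0n.
apply/eqP => s0; move: (subrX1 g m); rewrite s0 mulr0 => /eqP.
rewrite subr_eq0 => /eqP /(scalar_torsion_free gS m0) ge1.
by rewrite ge1 eqxx in g1.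
Qed.

Lemma scalar_expI (K : fieldType) (S : divisible_scalars K) g h m :
  g \in scalars S -> h \in scalars S -> (0 < m)%N -> g ^+ m = h ^+ m -> g = h.
Proof.
move=> gS hS m0 egh.
have h0 : h != 0 by apply/eqP => h0; have := scalar_neq0 S; rewrite -h0 hS.
apply/(divIf h0); rewrite divff //.
apply: (scalar_torsion_free _ m0); first exact: scalarM gS (scalarV hS).
by rewrite exprMn exprVn egh divff ?expf_neq0.
Qed.

Lemma affine_uniquely_divisible (K : numFieldType) (S : divisible_scalars K) :
  uniquely_divisible (affine S).
Proof.
move=> g m m0; have [h hS hm] := scalar_root (slopeP g) m0.
have s0 := scalar_sum_neq0 hS m0.
exists (Aff (shift g / \sum_(i < m) h ^+ i) hS); split.
  apply: aff_eq; first by rewrite slopeX.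
  by rewrite shiftX /= -[RHS](mulfVK s0).
move=> k km; have sk : slope k = h.
  by apply: (scalar_expI (slopeP k) hS m0); rewrite hm -km slopeX.
apply: aff_eq; rewrite ?sk //.
by rewrite -km shiftX sk /shift /= mulfK.
Qed.

Lemma not_universal_of_zero (K : numFieldType) (S : divisible_scalars K)
    (w : word) (x y : K) :
  (0 < Xcount w)%N -> x \in scalars S -> y \in scalars S ->
  value (word_poly w) x y = 0 -> ~ universal w.
Proof.
move=> n0 xS yS Pxy0 /(_ (affine S) (@affine_uniquely_divisible _ S)).
set a := Aff 0 yS; set b := word_eval (Aff 0 xS) a w.
move=> /(_ a (Aff 1 (slopeP b))) [g gB].
have sg : slope g = x.
  apply: (scalar_expI (slopeP g) xS n0).
  have := congr1 (@slope _ _) gB; rewrite slope_word /=.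
  have -> : slope (Aff 1 (slopeP b)) = slope b by [].
  by rewrite slope_word; apply/mulIf/expf_neq0/slope_neq0.
have := congr1 (@shift _ _) gB; rewrite shift_word // sg Pxy0 mulr0.
by move=> /esym/eqP; rewrite [shift _]/= oner_eq0.
Qed.

(** * Extending a torsion-free group of scalars to a divisible one *)

Definition scalar_group (K : fieldType) (H : set K) :=
  [/\ ~ H 0, (forall g h, H g -> H h -> H (g / h)) &
      forall g m, H g -> (0 < m)%N -> g ^+ m = 1 -> g = 1].

Section Extend.
Variable K : closedFieldType.
Local Open Scope classical_set_scope.
Implicit Types (H : set K).

Section Closure.
Variables (H : set K) (gH : scalar_group H) (nzH : H !=set0).

Lemma scalar_group1 : H 1.
Proof.
case: gH nzH => H0 Hd _ [g Hg]; rewrite -(@divff _ g); first exact: Hd.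
by apply/eqP => g0; rewrite g0 in Hg.
Qed.

Lemma scalar_groupV g : H g -> H g^-1.
Proof. by case: gH => _ Hd _ Hg; rewrite -div1r; apply/Hd/Hg/scalar_group1. Qed.

Lemma scalar_groupM g h : H g -> H h -> H (g * h).
Proof.
case: gH => _ Hd _ Hg Hh; rewrite -[h]invrK; exact/Hd/scalar_groupV.
Qed.

Lemma scalar_groupX g m : H g -> H (g ^+ m).
Proof.
move=> Hg; elim: m => [|m IHm]; first exact: scalar_group1.
by rewrite exprS; apply: scalar_groupM.
Qed.

Lemma scalar_group_nz g : H g -> g != 0.
Proof. by case: gH => H0 _ _ Hg; apply/eqP => g0; rewrite g0 in Hg. Qed.

End Closure.

(** Adjoining to H a p-th root h of an element g that has none in H creates no
torsion. If k h^n is torsion, then so is its p-th power k^p g^n, which lies in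
H and is therefore 1. For p dividing n, the element k h^n is itself in H;
otherwise a Bezout relation between n and p turns k^p g^n = 1 into a p-th root
of g in H. *)
Lemma adjoin_root H g h p : scalar_group H -> H g -> prime p -> h ^+ p = g ->
  (forall k, H k -> k ^+ p <> g) ->
  scalar_group [set z | exists k n, H k /\ z = k * h ^+ n].
Proof.
move=> gH Hg pp hp nroot; have nzH : H !=set0 by exists g.
have g0 := scalar_group_nz gH Hg.
have p0 := prime_gt0 pp.
have h0 : h != 0.
  by apply: contraNneq g0 => h0; rewrite -hp h0 expr0n gtn_eqF.
have hX := scalar_groupX gH nzH; have hM := scalar_groupM gH nzH.
have hV := scalar_groupV gH nzH.
split=> /=.
- move=> [k [n [Hk /eqP]]]; rewrite eq_sym mulf_eq0 expf_eq0 (negPf h0) andbF.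
  by rewrite orbF (negPf (scalar_group_nz gH Hk)).
- move=> _ _ [k [n [Hk ->]]] [k' [n' [Hk' ->]]].
  (* h^-1 is h^(p-1) / g, so natural exponents suffice *)
  exists (k / k' / g ^+ n'), (n + p.-1 * n')%N; split.
    by apply: (hM); [apply: hM => //; exact: hV | exact/hV/hX].
  have k'0 := scalar_group_nz gH Hk'.
  apply: (mulIf (mulf_neq0 k'0 (expf_neq0 n' h0))).
  rewrite mulfVK ?mulf_neq0 ?expf_neq0 //.
  rewrite exprD -[g]hp -exprM -[in h ^+ (p * n')](prednK p0) mulSn exprD.
  have := expf_neq0 n' h0; have := expf_neq0 (p.-1 * n') h0.
  move: (h ^+ n') (h ^+ (p.-1 * n')) (h ^+ n) => u v z v0 u0.
  by field; rewrite u0 v0 k'0.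
move=> _ m [k [n [Hk ->]]] m0 tors.
have [_ _ tf] := gH.
have kg1 : k ^+ p * g ^+ n = 1.
  apply: (tf _ m) => //; first by apply: hM; apply: hX.
  by rewrite -hp -exprM mulnC exprM -exprMn -exprM mulnC exprM tors expr1n.
have [/dvdnP[q nq]|npn] := boolP (p %| n)%N.
  apply: (tf _ m) => //; apply: hM => //.
  by rewrite nq mulnC exprM hp; apply: hX.
have cop : coprime n p by rewrite coprime_sym prime_coprime.
have n0 : (0 < n)%N by rewrite lt0n; apply: contraNneq npn => ->.
case: (egcdnP p n0) => u v uv _; exfalso.
rewrite (eqP cop) in uv.
apply: (nroot ((k ^+ u * g ^+ v)^-1)); first exact/hV/hM/hX/Hg/hX.
have ku0 := expf_neq0 u (scalar_group_nz gH Hk); have gv0 := expf_neq0 v g0.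
apply: (mulfI (expf_neq0 p (mulf_neq0 ku0 gv0))).
rewrite -exprMn divff ?expr1n; last first.
  by rewrite mulf_neq0 ?expf_neq0 // (scalar_group_nz gH Hk).
rewrite exprMn -!exprM -mulrA -exprSr -addn1 -uv (mulnC u p) (mulnC u n).
by rewrite !exprM -exprMn kg1 expr1n.
Qed.

(** A maximal torsion-free group has roots of all prime orders by
[adjoin_root], hence of all orders. *)
Lemma extend_scalar_group H : scalar_group H -> H !=set0 ->
  exists S : divisible_scalars K, forall g, H g -> g \in scalars S.
Proof.
move=> gH nzH.
(* the second clause is guarded because the union of the empty chain is empty *)
pose P A := scalar_group A /\ (A !=set0 -> H `<=` A).
have [|A [[gA HA] maxA]] := @Zorn_bigcup K P.
  move=> F FP totF; split; last first.
    move=> [z [A FA Az]] g Hg; exists A => //.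
    by apply: (FP _ FA).2 => //; exists z.
  split.
  - by move=> [A FA A0]; have [[]] := FP _ FA.
  - move=> g h [A FA Ag] [B FB Bh].
    have [AB|BA] := totF _ _ FA FB.
      by exists B => //; have [[_ + _] _] := FP _ FB; apply=> //; apply: AB.
    by exists A => //; have [[_ + _] _] := FP _ FA; apply=> //; apply: BA.
  - by move=> g m [A FA Ag]; have [[_ _ +] _] := FP _ FA; apply.
have nzA : A !=set0.
  apply: contrapT => A0; apply: (maxA H); last by split=> // _.
  split; first by move=> z Az; exfalso; apply: A0; exists z.
  by case: nzH => z Hz HsA; apply: A0; exists z; apply: HsA.
have {}HA := HA nzA.
have proot p g : prime p -> A g -> exists2 h, A h & h ^+ p = g.
  move=> pp Ag; apply: contrapT => nroot.
  have [h hp] : exists h, h ^+ p = g.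
    have /closed_rootP[h] : size ('X^p - g%:P) != 1.
      by rewrite size_XnsubC ?prime_gt0 // eqSS -lt0n prime_gt0.
    by rewrite /root !hornerE subr_eq0 => /eqP; exists h.
  have nr k : A k -> k ^+ p <> g by move=> Ak kp; apply: nroot; exists k.
  apply: (maxA _ _ (conj (adjoin_root gA Ag pp hp nr) _)).
    split; first by move=> k Ak; exists k, 0%N; rewrite expr0 mulr1.
    move=> /(_ h) Ah; apply: (nr h) => //; apply: Ah.
    by exists 1, 1%N; rewrite expr1 mul1r; split => //; apply: scalar_group1.
  by move=> _ k Hk; exists k, 0%N; rewrite expr0 mulr1; split=> //; apply: HA.
have root g m : g \in [pred z | `[< A z >]] -> (0 < m)%N ->
    exists2 h, h \in [pred z | `[< A z >]] & h ^+ m = g.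
  elim/ltn_ind: m g => m IHm g gA' m0; have [m1|m1] := eqVneq m 1%N.
    by exists g => //; rewrite m1 expr1.
  have m2 : (1 < m)%N by rewrite ltn_neqAle eq_sym m1.
  have pp := pdiv_prime m2; have pm := pdiv_dvd m.
  have [h Ah hp] := proot _ _ pp (asboolW gA').
  have [||k kA kh] := IHm (m %/ pdiv m)%N _ h (asboolT Ah).
  - by rewrite ltn_Pdiv ?prime_gt1.
  - by rewrite divn_gt0 ?prime_gt0 // dvdn_leq.
  by exists k => //; rewrite -hp -kh -exprM divnK.
unshelve eexists (@DivisibleScalars K [pred z | `[< A z >]] _ _ _ _ _ root).
- by apply/asboolPn; case: gA.
- by apply/asboolT/(scalar_group1 gA nzA).
- by move=> g h /asboolW Ag /asboolW Ah; exact/asboolT/(scalar_groupM gA nzA).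
- by move=> g /asboolW Ag; exact/asboolT/(scalar_groupV gA nzA).
- by move=> g m /asboolW Ag; case: gA => _ _; apply.
by move=> g /HA Ag; apply: asboolT.
Qed.
End Extend.

(** * Bivariate polynomials: Gauss's lemma and resultants *)

Lemma factor_of_map_horner (F : fieldType) (a : F) (d : {poly {poly F}}) :
  map_poly (horner_eval a) d = 0 -> exists e, d = ('X - a%:P) *: e.
Proof.
move=> d0; exists (map_poly (fun p => p %/ ('X - a%:P)) d).
apply/polyP => i; rewrite coefZ coef_map_id0 ?div0p // mulrC divpK //.
by rewrite dvdp_XsubCl rootE -/(horner_eval a d`_i) -coef_map d0 coef0.
Qed.

(** Gauss's lemma over an algebraically closed field: a root a of c makes the
product of the images of d and h in F[x] vanish at y = a, so that y - a
divides d or h and can be cancelled. Repeating this distributes all the linear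
factors of c between d and h. *)
Lemma gauss_factor (F : closedFieldType) (c : {poly F})
    (f d h : {poly {poly F}}) :
  c != 0 -> c *: f = d * h ->
  exists (c1 c2 : {poly F}) (d' h' : {poly {poly F}}),
    [/\ c = c1 * c2, d = c1 *: d', h = c2 *: h' & f = d' * h'].
Proof.
move: {2}(size c) (leqnn (size c)) => n.
elim: n c d h => [|n IHn] c d h; first by rewrite leqn0 size_poly_eq0 => ->.
have [c1|] := eqVneq (size c) 1%N.
  move=> _ nzc cf; have uc : c \is a GRing.unit.
    have lc : lead_coef c = c`_0 by rewrite lead_coefE c1.
    by rewrite poly_unitE c1 unitfE -lc lead_coef_eq0 nzc.
  exists c, 1, (c^-1 *: d), h; rewrite mulr1 scale1r scalerA mulrV // scale1r.
  by rewrite -scalerAl -cf scalerA mulVr // scale1r.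
move=> /closed_rootP[a /factor_theorem[c0 ->]] szc nzc cf.
have X0 : 'X - a%:P != 0 :> {poly F} by rewrite polyXsubC_eq0.
have XI : injective ( *:%R ('X - a%:P) : {poly {poly F}} -> {poly {poly F}}).
  by move=> p q; rewrite -!mul_polyC => /mulfI; apply; rewrite polyC_eq0.
have c00 : c0 != 0 by apply: contraNneq nzc => ->; rewrite mul0r.
have {}szc : (size c0 <= n)%N.
  by move: szc; rewrite size_Mmonic ?monicXsubC // size_XsubC addn2.
have /eqP : map_poly (horner_eval a) d * map_poly (horner_eval a) h = 0.
  rewrite -rmorphM -cf /= -mul_polyC rmorphM /= map_polyC /= /horner_eval.
  by rewrite hornerM hornerXsubC subrr mulr0 polyC0 mul0r.
rewrite mulf_eq0 => /orP[] /eqP /factor_of_map_horner [e def_e].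
  have [|c1 [c2 [d' [h' [ec ee eh ef]]]]] := IHn c0 e h szc c00.
    apply: XI; rewrite scalerA [_ * c0]mulrC cf def_e.
    by rewrite scalerAl.
  exists (c1 * ('X - a%:P)), c2, d', h'; split=> //; first by rewrite ec mulrAC.
  by rewrite def_e ee scalerA mulrC.
have [|c1 [c2 [d' [h' [ec ed ee ef]]]]] := IHn c0 d e szc c00.
  apply: XI; rewrite scalerA [_ * c0]mulrC cf def_e.
  by rewrite scalerAr.
exists c1, (c2 * ('X - a%:P)), d', h'; split=> //; first by rewrite ec mulrA.
by rewrite def_e ee scalerA mulrC.
Qed.

Lemma poly_unit_size (D : idomainType) (p : {poly D}) :
  p \is a GRing.unit -> size p = 1%N.
Proof. by rewrite poly_unitE => /andP[/eqP]. Qed.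

(** A vanishing resultant gives f and q a common factor of positive degree in x
over the fraction field of F[y]. Gauss's lemma turns it into a factor of the
irreducible f, thus into f itself up to a unit, and then clears the
denominators in its division of q. *)
Lemma resultant_irreducible_neq0 (F : closedFieldType)
    (f q : {poly {poly F}}) :
  irreducible_elt f -> (1 < size f)%N -> (forall k, q <> f * k) ->
  resultant f q != 0.
Proof.
move=> [f0 _ irrf] szf nfq; rewrite resultant_eq0 -leqNgt leqNgt.
apply/negP => szd; set d := gcdp f q in szd.
have /Pdiv.Idomain.dvdpP[[c h] /= c0 cf] : d %| f by apply: dvdp_gcdl.
have /Pdiv.Idomain.dvdpP[[b k] /= b0 bq] : d %| q by apply: dvdp_gcdr.
have [c1 [c2 [h' [d' [_ _ dd' fhd]]]]] := gauss_factor c0 cf.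
have uh' : h' \is a GRing.unit.
  have [//|/poly_unit_size szd'] := irrf _ _ fhd.
  by move: szd; rewrite dd' ltnNge (leq_trans (size_scale_leq _ _)) ?szd'.
have bqf : b *: q = (k * (c2 *: h'^-1)) * f.
  by rewrite bq dd' fhd -mulrA -scalerAl mulKr.
have [b1 [b2 [k' [f' [_ _ ff' qkf]]]]] := gauss_factor b0 bqf.
have [|ub|/poly_unit_size szf'] := irrf b2%:P f'; first by rewrite mul_polyC.
  apply: (nfq (k' * b2%:P^-1)).
  by rewrite ff' -mul_polyC qkf [RHS]mulrC mulrA divrK.
by move: szf; rewrite ff' ltnNge (leq_trans (size_scale_leq _ _)) ?szf'.
Qed.

(** * Binomials with a nonreal coefficient *)

(** Two exponents of y express y^n for any integer n without denominators;
the exponent a.+1 of x is always positive. *)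
Definition binomial_poly (C : nzRingType) (a c1 c2 : nat) (z : C) :
    {poly {poly C}} :=
  'X^c1 *: 'X^(a.+1) - (z *: 'X^c2)%:P.

Lemma size_binomial_poly (C : idomainType) a c1 c2 (z : C) :
  (1 < size (binomial_poly a c1 c2 z))%N.
Proof.
rewrite /binomial_poly size_polyDl size_scale ?size_polyXn ?monic_neq0 ?monicXn //.
by rewrite size_polyN (leq_ltn_trans (size_polyC_leq1 _)).
Qed.

Lemma binomial_polyE (C : comNzRingType) a c1 c2 (z s t : C) :
  (binomial_poly a c1 c2 z).[s%:P].[t] = t ^+ c1 * s ^+ a.+1 - z * t ^+ c2.
Proof. by rewrite /binomial_poly !hornerE. Qed.

Lemma map_binomial_poly (C D : nzRingType) (g : {rmorphism C -> D}) a c1 c2 z :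
  map_poly (map_poly g) (binomial_poly a c1 c2 z) = binomial_poly a c1 c2 (g z).
Proof.
by rewrite /binomial_poly rmorphB /= map_polyC /= !map_polyZ /= !map_polyXn.
Qed.

(** A real divisor would also divide the conjugate binomial, and so the
difference of the two, a nonzero polynomial in y alone. *)
Lemma real_not_dvd_binomial (C : numClosedFieldType) (f : {poly {poly C}})
    a c1 c2 (z : C) :
  (1 < size f)%N -> map_poly (map_poly Num.conj) f = f -> z^* != z ->
  forall k, binomial_poly a c1 c2 z <> f * k.
Proof.
move=> szf realf zz k qfk; pose cc := map_poly (map_poly (@Num.conj C)).
have : binomial_poly a c1 c2 z - cc (binomial_poly a c1 c2 z) = f * (k - cc k).
  by rewrite /cc qfk rmorphM /= realf mulrBr.
rewrite /cc map_binomial_poly /binomial_poly opprB addrC addrA subrK.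
rewrite -polyCB -scalerBl; set r := (_ *: _) => fkr.
have r0 : r != 0 by rewrite scaler_eq0 subr_eq0 negb_or zz monic_neq0 ?monicXn.
have k0 : k - cc k != 0.
  by apply: contraNneq r0 => k0; rewrite -polyC_eq0 fkr k0 mulr0.
have f0 : f != 0 by rewrite -size_poly_eq0 -lt0n ltnW.
have := size_mul f0 k0; rewrite -fkr size_polyC r0.
move: szf k0; rewrite -(size_poly_gt0 (k - _)).
by case: (size f) (size (k - _)) => [|[|m]] // [|n] // _ _; rewrite !addSn addnS.
Qed.

(** * A generic zero *)

(** Otherwise the countable set of all roots would contain an interval. *)
Lemma generic_positive (R : realType) (I : countType) (p : I -> {poly R[i]}) :
  (forall i, p i != 0) ->
  exists2 t : R, 0 < t & forall i, (p i).[t%:C%C] != 0.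
Proof.
move=> p0; apply: contrapT => nt.
pose Z i := [set t : R | root (p i) t%:C%C]%classic.
have cZ : countable (\bigcup_i Z i)%classic.
  apply: bigcup_countable => // i _; apply: finite_set_countable.
  have [rs def_p] := closed_field_poly_normal (p i).
  apply: (sub_finite_set _ (finite_seq [seq complex.Re z | z <- rs])) => t.
  rewrite /Z /= def_p rootZ ?lead_coef_eq0 ?p0 // root_prod_XsubC => trs.
  by apply/mapP; exists t%:C%C.
have sub : (`[1%R, 2%R] `<=` \bigcup_i Z i)%classic.
  move=> t /=; rewrite in_itv /= => /andP[t1 _]; apply: contrapT => nZ.
  apply: nt; exists t => [|i]; first exact: lt_le_trans t1.
  by apply/negP => ti; apply: nZ; exists i.
have := countable_lebesgue_measure0 (sub_countable (subset_card_le sub) cZ).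
rewrite lebesgue_measure_itv /= lte_fin ltr1n => /eqP.
by rewrite -EFinD eqe subr_eq0 pnatr_eq1.
Qed.

Lemma real_unity_root_sqr (C : numClosedFieldType) (z : C) N :
  (0 < N)%N -> z ^+ N = 1 -> z^* = z -> z ^+ 2 = 1.
Proof.
move=> N0 zN /CrealP zr; rewrite -real_normK //.
have /eqP := congr1 Num.norm zN; rewrite normrX normr1.
by rewrite pexpr_eq1 // => /eqP ->; rewrite expr1n.
Qed.

(** The point (s, t) lies on f, with t off the roots of every resultant of f and
a binomial x^(a+1) y^c1 - z y^c2 whose coefficient z is a nonreal root of unity;
then no such binomial vanishes at (s, t). When the exponent of s is 0 the
monomial is real because t is. *)
Lemma generic_zero (R : realType) (f : {poly {poly R[i]}}) :
  irreducible_elt f -> (1 < size f)%N -> map_poly (map_poly Num.conj) f = f ->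
  exists s t : R[i], [/\ t != 0, t^* = t, f.[s%:P].[t] = 0 &
    forall (m : nat) (n : int) N, (0 < N)%N ->
      (s ^+ m * t ^ n) ^+ N = 1 -> (s ^+ m * t ^ n)^* = s ^+ m * t ^ n].
Proof.
move=> irrf szf realf.
pose rs N := sval (closed_field_poly_normal ('X^(N.+1) - 1 : {poly R[i]})).
have rsP N z : z ^+ N.+1 = 1 -> z \in rs N.
  move=> zN; rewrite -root_prod_XsubC /rs; case: closed_field_poly_normal => r /=.
  rewrite lead_coefDl ?size_polyXn ?size_polyN ?size_poly1 // lead_coefXn scale1r.
  by move=> <-; rewrite rootE !hornerE zN subrr.
(* the leading coefficient is included so that f keeps a root in x at y = t *)
pose P (i : nat * nat * nat * nat) : {poly R[i]} :=
  let: (a, c1, c2, N) := i in lead_coef f *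
    \prod_(z <- rs N | z^* != z) resultant f (binomial_poly a c1 c2 z).
have P0 i : P i != 0.
  case: i => [[[a c1] c2] N]; rewrite mulf_neq0 //.
    by rewrite lead_coef_eq0; case: irrf.
  rewrite prodf_seq_neq0; apply/allP => z _; apply/implyP => zz.
  exact/resultant_irreducible_neq0/real_not_dvd_binomial.
have [t0 t0_gt0 Pt] := generic_positive P0.
set t : R[i] := t0%:C%C in Pt.
have tn0 : t != 0 by rewrite /t fmorph_eq0 gt_eqF.
have treal : t^* = t by apply/CrealP; rewrite complex_real.
have lead_t : (lead_coef f).[t] != 0.
  have := Pt (0, 0, 0, 0)%N; rewrite /P hornerM mulf_eq0 negb_or.
  by case/andP.
have sz_ft : size (map_poly (horner_eval t) f) = size f.
  by apply: size_map_poly_id0.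
have /closed_rootP[s] : size (map_poly (horner_eval t) f) != 1.
  by rewrite sz_ft gtn_eqF.
rewrite rootE -[s in _.[s]](hornerC s t) -/(horner_eval t s%:P) horner_map.
move=> /eqP; rewrite [LHS]/= /horner_eval => fst.
exists s, t; split=> // -[|a] n N N0; set z := (_ * _) => zN.
  by rewrite /z expr0 mul1r fmorphXz; congr (_ ^ n); exact: treal.
apply: contrapT => /eqP zz.
have nobin c1 c2 : t ^+ c1 * s ^+ a.+1 <> z * t ^+ c2.
  move=> e; have := Pt (a, c1, c2, N.-1); rewrite /P hornerM mulf_eq0 negb_or.
  rewrite horner_prod prodf_seq_neq0 => /andP[_ /allP /(_ z)].
  rewrite rsP ?prednK // zz => /(_ isT) /eqP; apply.
  have [[u v] /= [_ _]] := resultant_in_ideal szf (size_binomial_poly a c1 c2 z).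
  move=> /(congr1 (fun p => p.[s%:P].[t])).
  rewrite hornerC hornerD !hornerM hornerD !hornerM.
  by rewrite binomial_polyE fst e subrr !mulr0 addr0.
case: n @z {zN zz} nobin => n z nobin.
  by apply: (nobin n 0%N); rewrite mulr1 /z mulrC.
apply: (nobin 0%N n.+1); rewrite mul1r /z NegzE -exprnN -mulrA mulVf ?mulr1 //.
by rewrite expf_neq0.
Qed.

(** * Non-universality *)

(** A torsion element of this group is the square of a root of unity
z = s^m t^n that is real by hypothesis, hence equal to 1 or -1. *)
Lemma monomials_scalar_group (C : numClosedFieldType) (s t : C) :
  s != 0 -> t != 0 ->
  (forall (m : nat) (n : int) N, (0 < N)%N ->
      (s ^+ m * t ^ n) ^+ N = 1 -> (s ^+ m * t ^ n)^* = s ^+ m * t ^ n) ->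
  scalar_group [set z | exists m n : int, z = (s ^ m * t ^ n) ^+ 2]%classic.
Proof.
move=> s0 t0 tors; split=> /=.
- move=> [m [n /eqP]]; rewrite eq_sym expf_eq0 mulf_eq0 !expfz_eq0.
  by rewrite (negPf s0) (negPf t0) !andbF.
- move=> _ _ [m [n ->]] [m' [n' ->]]; exists (m - m'), (n - n').
  by rewrite !expfzDr // -!invr_expz; field; rewrite !expfz_neq0.
move=> _ N [m [n ->]] N0; rewrite -exprM => zN.
have N20 : (0 < 2 * N)%N by rewrite muln_gt0.
apply: (real_unity_root_sqr N20 zN).
case: m => m in zN *; first exact: tors N20 zN.
have zV : (s ^ Negz m * t ^ n)^-1 = s ^+ m.+1 * t ^ (- n).
  by rewrite invfM invrK -invr_expz.
apply: invr_inj; rewrite -fmorphV zV; apply: (tors _ _ _ N20).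
by rewrite -zV exprVn zN invr1.
Qed.

Lemma conj_map_intr (C : numClosedFieldType) (f : {poly {poly int}}) :
  map_poly (map_poly (@Num.conj C)) (map_poly (map_poly intr) f) =
  map_poly (map_poly intr) f.
Proof.
rewrite -map_poly_comp; apply: eq_map_poly => p /=.
by rewrite -map_poly_comp; apply: eq_map_poly => z /=; rewrite rmorph_int.
Qed.

(** At x = 0 the polynomial of a word beginning with X is 1, so the constant
coefficient of f is a unit and f, not being a unit, has positive degree. *)
Lemma size_factor_word_poly (K : idomainType) (w : word)
    (f g : {poly {poly int}}) :
  ohead w = Some LX -> sqr_vars (word_poly w) = f * g ->
  map_poly (map_poly intr) f \isn't a (@GRing.unit {poly {poly K}}) ->
  (1 < size (map_poly (map_poly intr) f : {poly {poly K}}))%N.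
Proof.
case: w => [|[] w] //= _ fg nuf; rewrite ltnNge; apply: contra nuf => szf.
have : (sqr_vars (word_poly (LX :: w)))`_0 = 1.
  rewrite /sqr_vars word_poly_X rmorphD rmorph1 rmorphM /= map_polyX -horner_coef0.
  by rewrite horner_comp !hornerE expr0n mul0r addr0.
rewrite fg coef0M => /(congr1 (map_poly (intr : int -> K))) fg1.
rewrite (size1_polyC szf) poly_unitE size_polyC coefC /= coef_map_id0 ?rmorph0 //.
have uf0 : map_poly intr f`_0 \is a (@GRing.unit {poly K}).
  apply/unitrPr; exists (map_poly intr g`_0).
  by have := fg1; rewrite rmorphM rmorph1.
by rewrite uf0 (contraTneq _ uf0) => [|->]; rewrite ?unitr0.
Qed.

Theorem corollary1p7 (R : realType) (w : word) (f : {poly {poly int}})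
    (w_begins_with_X : ohead w = Some LX)
    (f_factor : exists g : {poly {poly int}}, sqr_vars (word_poly w) = f * g)
    (f_irreducible : irreducible_elt (to_complex R f)) :
  ~ universal w.
Proof.
case: f_factor => g fg; have [_ nuf _] := f_irreducible.
have szf := size_factor_word_poly w_begins_with_X fg nuf.
have [s [t [t0 _ fst tors]]] := generic_zero f_irreducible szf (conj_map_intr _ f).
have zero : value (word_poly w) (s ^+ 2) (t ^+ 2) = 0.
  by rewrite -value_sqr_vars fg valueM [value f s t]fst mul0r.
have s0 : s != 0.
  apply: contraTneq (oner_neq0 R[i]) => s0; move: zero.
  case: w w_begins_with_X {fg} => [|[] v] //= _.
  by rewrite value_word_X s0 expr0n mul0r addr0 => ->; rewrite eqxx.
have [|S HS] := extend_scalar_group (monomials_scalar_group s0 t0 tors).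
  by exists 1, 0, 0; rewrite !expr0z mulr1 expr1n.
apply: (@not_universal_of_zero _ S w _ _ _ _ _ zero).
- by case: w w_begins_with_X {fg zero} => [|[] v].
- by apply: HS; exists 1, 0; rewrite mulr1.
- by apply: HS; exists 0, 1; rewrite mul1r.
Qed.
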